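(* The values of $n_3(3,d,1)$ for $d=1,2,\dots,15$ are, in order, $6,6,8,8,11,12,14,14,16,16,18,18,21,22,24$; moreover $n_3(3,17,1)=26$ and $n_3(3,21,1)=32$; and $n_3(3,d,1)=n_3(3,d)$ for all other positive integers $d$.
   Context: An $[n,k,d]_q$-code is a $k$-dimensional subspace of $\mathbb{F}_q^n$ with minimum Hamming distance at least $d$. $n_q(k,d)$ denotes the minimum length $n$ of an $[n,k,d]_q$-code. A linear code $C\subseteq\mathbb{F}_q^n$ has locality $r$ if for every coordinate $i$ there is a set $S_i\subseteq\{1,\dots,n\}\setminus\{i\}$ with $|S_i|\le r$ such that any two codewords agreeing on all coordinates in $S_i$ also agree in coordinate $i$. $n_q(k,d,r)$ denotes the minimum length $n$ of an $[n,k,d]_q$-code with locality $r$. *)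

(* Defs.v *)
From HB Require Import structures.
From mathcomp Require Import all_boot all_order all_algebra.
Set Implicit Arguments.
Unset Strict Implicit.
Unset Printing Implicit Defensive.

Definition hamming_dist (F : finFieldType) (n : nat) (x y : 'rV[F]_n) : nat :=
  #|[set i : 'I_n | x ord0 i != y ord0 i]|.

Definition is_code (F : finFieldType) (n k d : nat) (C : {vspace 'rV[F]_n}) :
    Prop :=
  \dim C = k /\
  (forall x y : 'rV[F]_n, x \in C -> y \in C -> x <> y ->
     d <= hamming_dist x y).

Definition has_locality (F : finFieldType) (n r : nat)
    (C : {vspace 'rV[F]_n}) : Prop :=
  forall i : 'I_n, exists S : {set 'I_n},
    [/\ i \notin S,
        #|S| <= r
      & forall x y : 'rV[F]_n, x \in C -> y \in C ->
          (forall j : 'I_n, j \in S -> x ord0 j = y ord0 j) ->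
          x ord0 i = y ord0 i].

Definition is_minimum (P : nat -> Prop) (n : nat) : Prop :=
  P n /\ (forall m : nat, P m -> n <= m).

(* n_q(k,d) = n, as a relation and with q = #|F|; asserting it includes the
   existence of a code with these parameters. *)
Definition min_length (F : finFieldType) (k d n : nat) : Prop :=
  is_minimum (fun m => exists C : {vspace 'rV[F]_m}, is_code k d C) n.

(* n_q(k,d,r) = n. *)
Definition min_length_loc (F : finFieldType) (k d r n : nat) : Prop :=
  is_minimum
    (fun m => exists C : {vspace 'rV[F]_m}, is_code k d C /\ has_locality r C)
    n.

(* Main.v *)
(** A ternary code of dimension 3 with generator matrix [G] is described by the
    number [m p] of columns of [G] on each point [p] of PG(2,3).  A nonzero
    message [u] has as weight the total multiplicity of the nine points off the
    line [u], and locality 1 says that no point has multiplicity exactly 1.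

    Summing the weights of the four lines through [p] gives
    [4 d + 3 m p <= 3 n].  As the nine points off a line carry at least [d],
    some [m p] is at least [d / 9], whence the Griesmer bound.  In the
    exceptional cases the same inequality forces [m p] into {0, 2, 3}, and a
    search over these multiplicities is infeasible.  Conversely, adding 2 to
    all multiplicities turns an optimal example for [d] into one for [d + 18],
    so that finitely many examples suffice. *)

Require Import Defs.
From HB Require Import structures.
From mathcomp Require Import all_boot all_order all_algebra.
From mathcomp Require Import zify.

Set Implicit Arguments.
Unset Strict Implicit.
Unset Printing Implicit Defensive.

Import GRing.Theory.

(** * The projective plane of order 3 *)

(** Natural-number coordinates instead of ['F_3], so that the finite checks can be settled by
    evaluation. *)
Definition vec3 := (nat * nat * nat)%type.

Definition dot3 (u v : vec3) : nat :=
  (u.1.1 * v.1.1 + u.1.2 * v.1.2 + u.2 * v.2) %% 3.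

Definition cube : seq vec3 :=
  [seq (a, c) | a <- [seq (x, y) | x <- iota 0 3, y <- iota 0 3], c <- iota 0 3].

(** Representatives whose first nonzero coordinate is 1; by duality they index the lines as well. *)
Definition points : seq vec3 :=
  [:: (0, 0, 1); (0, 1, 0); (0, 1, 1); (0, 1, 2); (1, 0, 0); (1, 0, 1);
      (1, 0, 2); (1, 1, 0); (1, 1, 1); (1, 1, 2); (1, 2, 0); (1, 2, 1);
      (1, 2, 2)].

Definition proportional (p v : vec3) : bool :=
  (v == p) || (v == (2 * p.1.1 %% 3, 2 * p.1.2 %% 3, 2 * p.2 %% 3)).

Definition off_line (u : vec3) : seq bool :=
  [seq dot3 u p != 0 | p <- points].

Lemma mem_cube (v : vec3) : (v \in cube) = [&& v.1.1 < 3, v.1.2 < 3 & v.2 < 3].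
Proof.
case: v => [[a b] c].
apply/allpairsP/idP => [[[e z] [/allpairsP[[x y] [hx hy He]] hz]]|].
  move: He => /= -> [-> -> ->]; move: hx hy hz.
  by rewrite !mem_iota => /= -> -> ->.
move=> /and3P[/= ha hb hc]; apply/allpairsP.
have lt3 x : x < 3 -> x \in iota 0 3 by rewrite mem_iota.
exact: (allpairs_f pair (allpairs_f pair (lt3 _ ha) (lt3 _ hb)) (lt3 _ hc)).
Qed.

Lemma points_cube : {subset points <= cube}.
Proof. by apply/allP; vm_compute. Qed.

(** Not an equality, because the zero vector, a possible column, is proportional to no point. *)
Lemma count_proportional :
  {in cube, forall v, count (fun p => proportional p v) points <= 1}.
Proof. by apply/allP; vm_compute. Qed.

Lemma count_off_line :
  {in points & cube, forall u v,
    count (fun p => (dot3 u p != 0) && proportional p v) points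
      = (dot3 u v != 0)}.
Proof.
have H : all (fun u => all (fun v =>
    count (fun p => (dot3 u p != 0) && proportional p v) points
      == (dot3 u v != 0)) cube) points by vm_compute.
by move=> u v /(allP H)/allP{}H /H /eqP.
Qed.

(** A nonzero vector and its normalised multiple vanish on the same points, so the weights of
    thirteen messages determine the minimum distance. *)
Lemma point_of_vec :
  {in cube, forall v, v != (0, 0, 0) ->
    exists2 u, u \in points
      & {in points, forall p, (dot3 v p != 0) = (dot3 u p != 0)}}.
Proof.
have H : all (fun v => (v != (0, 0, 0)) ==>
    has (fun u => all (fun p =>
      (dot3 v p != 0) == (dot3 u p != 0)) points) points) cube by vm_compute.
move=> v /(allP H)/implyP{}H /H /hasP[u uP /allP uv].
by exists u => // p /uv /eqP.
Qed.

Lemma separating_line (p v w : vec3) :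
  p \in points -> v \in cube -> w \in cube ->
  proportional p v -> ~~ proportional p w ->
  exists2 u, u \in cube & (dot3 u w == 0) && (dot3 u v != 0).
Proof.
have H : all (fun p => all (fun v => all (fun w =>
    proportional p v ==> ~~ proportional p w ==>
    has (fun u => (dot3 u w == 0) && (dot3 u v != 0)) cube) cube) cube) points
  by vm_compute.
move=> /(allP H)/allP{}H /H/allP{}H /H/implyP{}H /H/implyP{}H /H.
by move/hasP.
Qed.

Lemma count_off_line9 : {in points, forall u, count id (off_line u) = 9}.
Proof. by move=> u up; apply/eqP; move: u up; apply/allP; vm_compute. Qed.

(** * Multiplicity vectors *)

Definition covers (d : nat) (m : seq nat) : bool :=
  all (fun b => d <= sumn (mask b m)) [seq off_line u | u <- points].

Definition no_single (m : seq nat) : bool := all (fun x => x != 1) m.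

Lemma coversP (d : nat) (m : seq nat) :
  reflect {in points, forall u, d <= sumn (mask (off_line u) m)} (covers d m).
Proof. by rewrite /covers all_map; apply: allP. Qed.

Lemma sumn_mask_map (T : Type) (f : T -> bool) (g : T -> nat) (s : seq T) :
  sumn (mask (map f s) (map g s)) = \sum_(x <- s | f x) g x.
Proof. by rewrite -map_mask -filter_mask sumnE big_map big_filter. Qed.

Lemma sumn_mask_shift (c : nat) (b : seq bool) (m : seq nat) :
  size b = size m ->
  sumn (mask b (map (addn c) m)) = sumn (mask b m) + c * count id b.
Proof.
elim: b m => [|[] b IH] [|x m] //=; first by rewrite muln0.
  by case=> /IH ->; rewrite mulnDr muln1; lia.
by case=> /IH ->.
Qed.

Lemma covers_shift (c d : nat) (m : seq nat) :
  size m = 13 -> covers d m -> covers (d + 9 * c) (map (addn c) m).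
Proof.
move=> sm /coversP cov; apply/coversP => u up.
rewrite sumn_mask_shift ?size_map ?sm // count_off_line9 // mulnC.
by rewrite leq_add2r cov.
Qed.

Lemma sumn_shift (c : nat) (m : seq nat) :
  sumn (map (addn c) m) = sumn m + c * size m.
Proof. by elim: m => [|x m /= ->]; rewrite /= ?muln0 //; lia. Qed.

(* Sum the weights of the four lines through the point. *)
Lemma multiplicity_bound (d : nat) (m : seq nat) :
  size m = 13 -> covers d m -> all (fun x => 4 * d + 3 * x <= 3 * sumn m) m.
Proof.
move: m; do 13! [case=> // ?]; case=> // _; rewrite /covers.
set L := map _ _; vm_compute in L; rewrite {}/L /=.
(* Every other point lies on exactly one of the four lines through the chosen point, hence is
   counted three times, while the chosen point is never counted. *)
by repeat (case/andP => ?); move=> _; lia.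
Qed.

(** The sum of the ceilings of [d], [d / 3] and [d / 9]: the Griesmer bound in dimension 3. *)
Definition griesmer (d : nat) : nat := d + (d + 2) %/ 3 + (d + 8) %/ 9.

Lemma griesmer_bound (d : nat) (m : seq nat) :
  size m = 13 -> covers d m -> griesmer d <= sumn m.
Proof.
move=> sm cov; have bnd := multiplicity_bound sm cov.
rewrite leqNgt; apply/negP => lt.
have small x : x \in m -> x <= ((d + 8) %/ 9).-1.
  (* The term [3 * ((d + 2) %/ 3)] exceeds [d] by at most 2, a slack that vanishes on dividing by
     3. *)
  move=> /(allP bnd); rewrite /griesmer in lt; lia.
have : d <= 9 * ((d + 8) %/ 9).-1.
  have /coversP/(_ (0, 0, 1) isT) := cov => /leq_trans; apply.
  move: (_.-1) small => c small.
  have <- : size (mask (off_line (0, 0, 1)) m) = 9.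
    by rewrite size_mask ?sm // count_off_line9.
  have: {subset mask (off_line (0, 0, 1)) m <= m} by move=> x; apply: mem_mask.
  elim: (mask _ _) => //= x s IH sub; rewrite mulSn leq_add //.
    by rewrite small // sub ?mem_head.
  by apply: IH => y ys; rewrite sub // inE ys orbT.
(* At [d = 0] the truncated predecessor would leave no contradiction; but [griesmer 0] is 0, so [lt]
   rules this case out. *)
have : 0 < d by case: d lt {cov bnd small} => //.
lia.
Qed.

(** * Exhaustive search *)

(* A constraint [(a, b)] asks the next [size b] multiplicities to contribute at
   least [a] at the positions marked by [b]. *)
Definition advance (v : nat) (c : nat * seq bool) : nat * seq bool :=
  (c.1 - (if head false c.2 then v else 0), behead c.2).

(* Written with [if] because the call-by-value evaluation of [&&] would defeat
   the pruning. *)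
Fixpoint feasible (k budget : nat) (cs : seq (nat * seq bool)) : bool :=
  if all (fun c => c.1 <= minn budget (3 * count id c.2)) cs then
    match k with
    | 0 => all (fun c => c.1 == 0) cs
    | k'.+1 => has (fun v => if v <= budget
                             then feasible k' (budget - v) (map (advance v) cs)
                             else false) [:: 0; 2; 3]
    end
  else false.

Lemma sumn_mask_leq (b : seq bool) (m : seq nat) : sumn (mask b m) <= sumn m.
Proof.
elim: b m => [|[] b IH] [|x m] //=; first by rewrite leq_add2l.
by rewrite (leq_trans (IH m)) // leq_addl.
Qed.

Lemma sumn_mask_leq_count (k : nat) (b : seq bool) (m : seq nat) :
  all (fun x => x <= k) m -> sumn (mask b m) <= k * count id b.
Proof.
elim: b m => [|[] b IH] [|x m] //= /andP[xk /IH{}IH] //.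
by rewrite mulnDr muln1 leq_add.
Qed.

(** Pruning loses no solution: what the remaining entries contribute to a constraint is at most
    their total, hence the budget, and at most 3 per marked position. *)
Lemma feasible_complete (xs : seq nat) (budget : nat)
    (cs : seq (nat * seq bool)) :
  all (fun x => x \in [:: 0; 2; 3]) xs -> sumn xs <= budget ->
  all (fun c => c.1 <= sumn (mask c.2 xs)) cs ->
  feasible (size xs) budget cs.
Proof.
elim: xs budget cs => [|x xs IH] budget cs /= => [_ _|].
  move=> H; have H0 : all (fun c => c.1 == 0) cs.
    by apply: sub_all H => c; rewrite mask0 leqn0.
  by rewrite H0 ifT //; apply: sub_all H0 => c /eqP ->.
case/andP=> xv xsv le_b H; rewrite ifT; last first.
  apply: sub_all H => c cx; apply: leq_trans cx _.
  rewrite leq_min (leq_trans (sumn_mask_leq _ (x :: xs)) le_b) /=.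
  apply: (@sumn_mask_leq_count 3 _ (x :: xs)).
  have le3 y : y \in [:: 0; 2; 3] -> y <= 3 by rewrite !inE; lia.
  by apply/andP; split; [apply: le3 | apply: sub_all xsv].
have: if x <= budget
      then feasible (size xs) (budget - x) (map (advance x) cs) else false.
  rewrite ifT; last by lia.
  apply: IH => //; first by lia.
  by rewrite all_map; apply: sub_all H => -[a [|[] b]] /=; rewrite ?mask0s; lia.
by move: xv; rewrite !inE => /or3P[]/eqP-> /= ->; rewrite ?orbT.
Qed.

(** If the total were at most [N], then [multiplicity_bound] would give [3 * x < 12] for each entry;
    excluding 1 leaves the values 0, 2, 3 that the search tries. *)
Lemma search_bound (d N : nat) (m : seq nat) :
  size m = 13 -> covers d m -> no_single m -> 3 * N < 4 * d + 12 ->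
  ~~ feasible 13 N [seq (d, off_line u) | u <- points] -> N < sumn m.
Proof.
move=> sm cov m1 Nd; apply: contraR; rewrite -leqNgt -sm => mN.
have met : all (fun c => c.1 <= sumn (mask c.2 m))
    [seq (d, off_line u) | u <- points] by rewrite all_map; apply/allP/coversP.
apply: feasible_complete met => //.
have bnd := multiplicity_bound sm cov.
apply/allP => x xm; have := allP bnd _ xm; have := allP m1 _ xm.
by rewrite !inE; lia.
Qed.

(** * Codes and multiplicity vectors *)

(** Applied both to messages, as [u ord0], and to columns, as [fun i => G i j]. *)
Definition vec_of (f : 'I_3 -> 'F_3) : vec3 :=
  (f ord0 : nat, f (lift ord0 ord0) : nat, f (lift ord0 (lift ord0 ord0)) : nat).

Definition row_of (v : vec3) : 'rV['F_3]_3 :=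
  \row_i nth 0%R [:: v.1.1%:R; v.1.2%:R; v.2%:R]%R i.

Lemma vec_of_cube (f : 'I_3 -> 'F_3) : vec_of f \in cube.
Proof. by rewrite mem_cube /= !ltn_ord. Qed.

Lemma row_ofK : {in cube, forall v, vec_of (row_of v ord0) = v}.
Proof.
case=> [[a b] c]; rewrite mem_cube => /and3P[/= ha hb hc].
by rewrite /vec_of !mxE /= !val_Fp_nat // !modn_small.
Qed.

Lemma vec_of_eq0 (u : 'rV['F_3]_3) : vec_of (u ord0) = (0, 0, 0) -> u = 0%R.
Proof.
case=> h0 h1 h2; apply/rowP => i; rewrite mxE; apply: val_inj.
have -> : val (0 : 'F_3)%R = 0 by [].
case: i => [[|[|[|//]]]] Hi /=.
- by rewrite -[RHS]h0; congr (val (u _ _)); apply: val_inj.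
- by rewrite -[RHS]h1; congr (val (u _ _)); apply: val_inj.
- by rewrite -[RHS]h2; congr (val (u _ _)); apply: val_inj.
Qed.

Lemma val_mulmx (n : nat) (u : 'rV['F_3]_3) (G : 'M['F_3]_(3, n)) (j : 'I_n) :
  nat_of_ord ((u *m G)%R ord0 j)
    = dot3 (vec_of (u ord0)) (vec_of (fun i => G i j)).
Proof.
rewrite mxE !big_ord_recl big_ord0 addr0 /dot3 /=.
by rewrite !modnDml !modnDmr !addnA modnDmr.
Qed.

Definition codeword_weight (n : nat) (x : 'rV['F_3]_n) : nat :=
  #|[set j | x ord0 j != 0%R]|.

Lemma hamming_dist_sub (n : nat) (x y : 'rV['F_3]_n) :
  hamming_dist x y = codeword_weight (x - y)%R.
Proof. by apply: eq_card => j; rewrite !inE !mxE subr_eq0. Qed.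

Definition point_mult (n : nat) (G : 'M['F_3]_(3, n)) : seq nat :=
  [seq #|[set j | proportional p (vec_of (fun i => G i j))]| | p <- points].

(** Double counting of pairs of a point and a column lying on it. *)
Lemma sum_point_mult (n : nat) (G : 'M['F_3]_(3, n)) (f : pred vec3) :
  sumn (mask (map f points) (point_mult G))
    = \sum_(j < n) count
        (fun p => f p && proportional p (vec_of (fun i => G i j))) points.
Proof.
rewrite sumn_mask_map.
under eq_bigr => p _ do rewrite -sum1dep_card big_mkcond.
rewrite exchange_big; apply: eq_bigr => j _.
by rewrite -sum1_count big_mkcondr.
Qed.

Lemma sumn_point_mult (n : nat) (G : 'M['F_3]_(3, n)) :
  sumn (point_mult G) <= n.
Proof.
have -> : sumn (point_mult G) = sumn (mask (map xpredT points) (point_mult G)).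
  by rewrite /= !addnA.
rewrite sum_point_mult -[leqRHS]card_ord -sum1_card; apply: leq_sum => j _.
exact/count_proportional/vec_of_cube.
Qed.

Lemma weight_point_mult (n : nat) (G : 'M['F_3]_(3, n)) (u : vec3) :
  u \in points ->
  sumn (mask (off_line u) (point_mult G)) = codeword_weight (row_of u *m G)%R.
Proof.
move=> up; rewrite sum_point_mult /codeword_weight -sum1dep_card [RHS]big_mkcond.
apply: eq_bigr => j _; rewrite count_off_line ?vec_of_cube //.
have -> : ((row_of u *m G)%R ord0 j != 0%R)
  = (nat_of_ord ((row_of u *m G)%R ord0 j) != 0) by [].
by rewrite val_mulmx row_ofK ?points_cube //; case: eqP.
Qed.

(** * From a code to its multiplicities *)

Lemma generator_matrix (F : finFieldType) (n k : nat) (C : {vspace 'rV[F]_n}) :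
  \dim C = k ->
  exists2 G : 'M[F]_(k, n), (forall u : 'rV_k, (u *m G)%R \in C)
    & forall u : 'rV_k, (u *m G = 0)%R -> u = 0%R.
Proof.
move=> <-; exists (\matrix_i (vbasis C)`_i)%R => u; rewrite mulmx_sum_row.
  apply: memv_suml => i _; rewrite rowK memvZ // vbasis_mem //.
  by rewrite mem_nth // size_tuple.
under eq_bigr => i _ do rewrite rowK.
move/(freeP (basis_free (vbasisP C)) (u 0%R)) => u0.
by apply/rowP => i; rewrite u0 mxE.
Qed.

(** Suppose column [j] alone lies on [p]. A message orthogonal to the column in the recovery set of
    [j], but not to column [j], gives a codeword that agrees with 0 on that set and differs from 0
    at [j]. *)
Lemma code_multiplicities (n d : nat) (C : {vspace 'rV['F_3]_n}) :
  is_code 3 d C ->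
  exists m : seq nat, [/\ size m = 13, sumn m <= n, covers d m
    & has_locality 1 C -> no_single m].
Proof.
case=> dimC distC; have [G GC Ginj] := generator_matrix dimC.
exists (point_mult G); split => //; first exact: sumn_point_mult.
  apply/coversP => u up; rewrite weight_point_mult //.
  rewrite -[X in codeword_weight X]subr0 -hamming_dist_sub.
  apply: distC; rewrite ?GC ?mem0v // => /Ginj u0.
  have := row_ofK (points_cube up); rewrite u0 /vec_of !mxE => ue.
  by move: up; rewrite -ue.
move=> loc; rewrite /no_single all_map; apply/allP => p pp /=.
apply/negP => /cards1P[j jE].
have pj : proportional p (vec_of (fun i => G i j)).
  by have := set11 j; rewrite -jE inE.
have pNj j' : j' != j -> ~~ proportional p (vec_of (fun i => G i j')).
  by move=> nj; have := in_set1 j' j; rewrite -jE inE (negPf nj) => ->.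
have [S [jS S1 det]] := loc j.
(* An empty recovery set is represented by the zero vector, which is orthogonal to every message. *)
have [w [wc pw wS]] : exists w, [/\ w \in cube, ~~ proportional p w
    & forall j', j' \in S -> w = vec_of (fun i => G i j')].
  have [S0|[j' j'S]] := set_0Vmem S.
    exists (0, 0, 0); split=> // [|j']; last by rewrite S0 inE.
    by move: p pp {jE pj pNj}; apply/allP; vm_compute.
  exists (vec_of (fun i => G i j')); split; first exact: vec_of_cube.
    by apply: pNj; apply: contraNneq jS => <-.
  by move=> j2 j2S; rewrite (card_le1_eqP S1 _ _ j'S j2S).
have [u uc /andP[uw /negP[]]] := separating_line pp (vec_of_cube _) wc pj pw.
rewrite -{1}(row_ofK uc) -val_mulmx; apply/eqP.
rewrite (det _ 0%R) ?mem0v ?mxE // => j' /wS wE; rewrite [RHS]mxE.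
by apply: val_inj; rewrite /= val_mulmx -wE row_ofK //; apply/eqP.
Qed.

(** * From multiplicities to a code with locality 1 *)

Lemma card_nth (T : Type) (x0 : T) (P : pred T) (s : seq T) :
  #|[set j : 'I_(size s) | P (nth x0 s j)]| = count P s.
Proof. by rewrite -sum1dep_card -sum1_count (big_nth x0) big_mkord. Qed.

(** With the points of [l] as columns, nonzero messages have weight at least [d], which is positive,
    so encoding is injective and the dimension is 3. A second copy of a column recovers its
    coordinate. *)
Lemma code_of_points (l : seq vec3) (d : nat) :
  0 < d -> {subset l <= points} ->
  {in points, forall u, d <= count (fun p => dot3 u p != 0) l} ->
  {in l, forall p, 1 < count_mem p l} ->
  exists C : {vspace 'rV['F_3]_(size l)}, is_code 3 d C /\ has_locality 1 C.
Proof.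
move=> d_gt0 lp lw lm; pose p0 : vec3 := (0, 0, 0).
pose G : 'M['F_3]_(3, size l) := (\matrix_(i, j) row_of (nth p0 l j) ord0 i)%R.
have vecG j : vec_of (fun i => G i j) = nth p0 l j.
  by rewrite -[RHS]row_ofK ?points_cube ?lp ?mem_nth // /vec_of !mxE.
have weightG (u : 'rV['F_3]_3) : u != 0%R -> d <= codeword_weight (u *m G)%R.
  move=> u0; have v0 : vec_of (u ord0) != (0, 0, 0).
    by apply: contraNneq u0 => /vec_of_eq0 ->.
  have [u' u'p uu'] := point_of_vec (vec_of_cube _) v0.
  rewrite (leq_trans (lw _ u'p)) // -(card_nth p0).
  apply/eq_leq/eq_card => j; rewrite !inE -uu' ?lp ?mem_nth //.
  by rewrite -vecG -val_mulmx.
have injG (u : 'rV['F_3]_3) : (u *m G = 0)%R -> u = 0%R.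
  move=> uG; have [//|/weightG] := eqVneq u 0%R.
  rewrite uG /codeword_weight (_ : [set _ | _] = set0).
    by rewrite cards0 leqNgt d_gt0.
  by apply/setP => j; rewrite !inE mxE eqxx.
pose f := linfun (mulmxr G : 'rV['F_3]_3 -> 'rV['F_3]_(size l)).
have fE u : f u = (u *m G)%R by rewrite lfunE.
exists (limg f); split; first split.
- rewrite limg_dim_eq ?dimvf ?dim_matrix //.
  apply/eqP; rewrite -subv0; apply/subvP => u.
  by rewrite memv_cap memv_ker fE memv0 => /andP[_ /eqP/injG ->].
- move=> _ _ /memv_imgP[u _ ->] /memv_imgP[v _ ->] neq.
  rewrite hamming_dist_sub !fE -mulmxBl; apply: weightG.
  by rewrite subr_eq0; apply/eqP => uv; rewrite uv in neq.
move=> j; pose p := nth p0 l j.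
have /card_gt1P[j1 [j2 [h1 h2 neq]]] :
    1 < #|[set j' : 'I_(size l) | nth p0 l j' == p]|.
  by have := lm _ (mem_nth p0 (ltn_ord j)); rewrite -(card_nth p0).
have [j' j'p neqj] : exists2 j' : 'I_(size l), nth p0 l j' = p & j != j'.
  rewrite !inE in h1 h2.
  have [ej|] := eqVneq j j1; last by exists j1 => //; apply/eqP.
  by exists j2; [apply/eqP | rewrite ej].
exists [set j']; split; [by rewrite inE | by rewrite cards1 |].
move=> _ _ /memv_imgP[u _ ->] /memv_imgP[v _ ->] /(_ j' (set11 _)).
suff E w : (f w) ord0 j = (f w) ord0 j' by rewrite -!E.
by rewrite !fE !mxE; apply: eq_bigr => i _; rewrite !mxE j'p.
Qed.

Lemma count_tally_zip (T : eqType) (P : pred T) (s : seq T) (m : seq nat) :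
  count P (tally_seq (zip s m)) = sumn (mask (map P s) m).
Proof.
elim: s m => [|a s IH] [|x m] //=.
rewrite /tally_seq /= count_cat count_nseq -/(tally_seq _) IH.
by case: (P a); rewrite ?mul1n.
Qed.

Lemma tally_zip_gt1 (T : eqType) (s : seq T) (m : seq nat) :
  no_single m ->
  {in tally_seq (zip s m), forall p, 1 < count_mem p (tally_seq (zip s m))}.
Proof.
elim: s m => [|a s IH] [|x m] //= /andP[x1 /IH{}IH] p.
rewrite /tally_seq /= mem_cat count_cat count_nseq -/(tally_seq _).
case/orP=> [|/IH]; last by lia.
by rewrite mem_nseq /= => /andP[x0 /eqP ->]; rewrite eqxx; lia.
Qed.

Lemma mem_tally_zip (T : eqType) (s : seq T) (m : seq nat) :
  {subset tally_seq (zip s m) <= s}.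
Proof.
elim: s m => [|a s IH] [|x m] //= p; rewrite /tally_seq /= mem_cat mem_nseq.
by rewrite inE; case/orP=> [/andP[_ ->] //|/IH ->]; rewrite orbT.
Qed.

(** The columns are listed by [tally_seq (zip points m)], which repeats each point as often as [m]
    prescribes. *)
Lemma code_of_multiplicities (d : nat) (m : seq nat) :
  0 < d -> size m = 13 -> covers d m -> no_single m ->
  exists C : {vspace 'rV['F_3]_(sumn m)}, is_code 3 d C /\ has_locality 1 C.
Proof.
move=> d_gt0 sm /coversP cov m1.
have -> : sumn m = size (tally_seq (zip points m)).
  by rewrite size_tally_seq unzip2_zip ?sm.
apply: code_of_points => //; first exact: mem_tally_zip.
  by move=> u up; rewrite count_tally_zip cov.
exact: tally_zip_gt1.
Qed.

(** * The examples *)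

(* Entry [d - 1] is an optimal multiplicity vector for minimum distance [d],
   in the order of [points]; found by computer search. *)
Definition examples : seq (seq nat) := [::
  [:: 2; 2; 0; 0; 2; 0; 0; 0; 0; 0; 0; 0; 0];
  [:: 2; 2; 0; 0; 2; 0; 0; 0; 0; 0; 0; 0; 0];
  [:: 2; 2; 0; 0; 2; 0; 0; 0; 2; 0; 0; 0; 0];
  [:: 2; 2; 0; 0; 2; 0; 0; 0; 2; 0; 0; 0; 0];
  [:: 3; 3; 0; 0; 3; 0; 0; 0; 2; 0; 0; 0; 0];
  [:: 4; 2; 0; 0; 2; 0; 0; 2; 0; 0; 0; 2; 0];
  [:: 4; 3; 0; 0; 3; 0; 0; 0; 2; 0; 0; 2; 0];
  [:: 2; 2; 2; 0; 2; 2; 0; 2; 2; 0; 0; 0; 0];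
  [:: 3; 3; 0; 0; 2; 2; 0; 2; 2; 0; 0; 0; 2];
  [:: 2; 2; 2; 0; 2; 2; 0; 2; 0; 2; 0; 2; 0];
  [:: 3; 3; 0; 0; 2; 2; 0; 2; 0; 2; 0; 2; 2];
  [:: 2; 2; 2; 0; 2; 2; 0; 2; 0; 2; 0; 2; 2];
  [:: 3; 3; 2; 0; 3; 2; 0; 2; 0; 2; 0; 2; 2];
  [:: 3; 3; 2; 0; 3; 2; 0; 2; 0; 3; 0; 2; 2];
  [:: 4; 3; 2; 0; 3; 2; 0; 3; 0; 2; 0; 3; 2];
  [:: 2; 2; 2; 2; 2; 2; 2; 2; 2; 2; 2; 2; 0];
  [:: 3; 3; 3; 0; 3; 3; 0; 3; 0; 3; 0; 3; 2];
  [:: 2; 2; 2; 2; 2; 2; 2; 2; 2; 2; 2; 2; 2];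
  [:: 3; 3; 3; 0; 3; 2; 2; 2; 2; 3; 2; 2; 2];
  [:: 3; 3; 3; 0; 3; 2; 2; 2; 2; 3; 2; 3; 2];
  [:: 4; 4; 3; 0; 3; 2; 2; 2; 2; 3; 2; 3; 2];
  [:: 3; 3; 3; 2; 3; 3; 2; 3; 3; 2; 2; 2; 2];
  [:: 3; 3; 3; 2; 3; 3; 2; 3; 2; 3; 2; 3; 2];
  [:: 3; 3; 3; 2; 3; 3; 2; 3; 2; 3; 2; 3; 3];
  [:: 3; 3; 3; 3; 3; 3; 3; 3; 3; 3; 3; 2; 2];
  [:: 3; 3; 3; 3; 3; 3; 3; 3; 3; 3; 3; 3; 2];
  [:: 3; 3; 3; 3; 3; 3; 3; 3; 3; 3; 3; 3; 3];
  [:: 4; 4; 4; 2; 4; 4; 2; 4; 3; 3; 2; 3; 3];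
  [:: 4; 4; 4; 2; 4; 4; 2; 4; 2; 4; 2; 4; 3];
  [:: 4; 4; 4; 2; 4; 4; 2; 4; 2; 4; 2; 4; 4];
  [:: 4; 4; 4; 3; 4; 4; 3; 4; 4; 3; 3; 3; 3];
  [:: 4; 4; 4; 3; 4; 4; 3; 4; 3; 4; 3; 4; 3];
  [:: 4; 4; 4; 3; 4; 4; 3; 4; 3; 4; 3; 4; 4];
  [:: 4; 4; 4; 4; 4; 4; 4; 4; 4; 4; 4; 4; 2];
  [:: 4; 4; 4; 4; 4; 4; 4; 4; 4; 4; 4; 4; 3];
  [:: 4; 4; 4; 4; 4; 4; 4; 4; 4; 4; 4; 4; 4];
  [:: 5; 5; 5; 3; 5; 5; 3; 5; 4; 4; 3; 4; 4];
  [:: 5; 5; 5; 3; 5; 5; 3; 5; 3; 5; 3; 5; 4];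
  [:: 5; 5; 5; 3; 5; 5; 3; 5; 3; 5; 3; 5; 5]
].

Definition is_example (d n : nat) (m : seq nat) : bool :=
  [&& size m == 13, covers d m, no_single m & sumn m == n].

Definition exceptional_values : seq (nat * nat) :=
  zip (iota 1 15) [:: 6; 6; 8; 8; 11; 12; 14; 14; 16; 16; 18; 18; 21; 22; 24]
    ++ [:: (17, 26); (21, 32)].

(** The tabulated vector attains [n], and the search with budget [n - 1] fails. *)
Lemma min_length_loc_exceptional (d n : nat) :
  (d, n) \in exceptional_values -> min_length_loc 'F_3 3 d 1 n.
Proof.
have H : all (fun dn => [&& 0 < dn.1, 0 < dn.2,
    is_example dn.1 dn.2 (nth [::] examples dn.1.-1),
    3 * dn.2.-1 < 4 * dn.1 + 12
  & ~~ feasible 13 dn.2.-1 [seq (dn.1, off_line u) | u <- points]])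
  exceptional_values by vm_compute.
move=> /(allP H) /and5P[d0 n0 /and4P[/eqP sm cov m1 /eqP sum] Nd search].
have {}sum : sumn _ = n := sum; have {}n0 : 0 < n := n0.
split; first by rewrite -sum; apply: code_of_multiplicities.
move=> n' [C [/code_multiplicities[m' [sm' le cov' m1']] /m1'{}m1']].
apply: leq_trans le; rewrite -(ltn_predK n0).
exact: search_bound sm' cov' m1' Nd search.
Qed.

(** Passing from [d - 18] to [d] raises the Griesmer bound by 26, which is 2 for each of the 13
    points; adding only 1 could create a multiplicity 1. The table runs up to 39 because 35 and 39
    would descend to the exceptions 17 and 21. *)
Lemma griesmer_example (d : nat) :
  15 < d -> d <> 17 -> d <> 21 -> exists m, is_example d (griesmer d) m.
Proof.
elim/ltn_ind: d => d IH d15 d17 d21; have [d40|d40] := ltnP d 40.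
  have H : all (fun d => (d \in [:: 17; 21]) ||
    is_example d (griesmer d) (nth [::] examples d.-1)) (iota 16 24)
    by vm_compute.
  exists (nth [::] examples d.-1).
  have /(allP H) : d \in iota 16 24 by rewrite mem_iota; lia.
  by rewrite !inE => /orP[/orP[]/eqP|].
have [|||| m /and4P[/eqP sm cov m1 /eqP sum]] := IH (d - 18); try lia.
exists (map (addn 2) m); apply/and4P; split.
- by rewrite size_map sm.
- by have := covers_shift 2 sm cov; rewrite subnK //; lia.
- by rewrite /no_single all_map; apply/allP => x.
- by rewrite sumn_shift sm sum /griesmer; lia.
Qed.

Theorem theorem40 :
  [/\ forall d : nat, 1 <= d <= 15 ->
        min_length_loc 'F_3 3 d 1
          (nth 0 [:: 6; 6; 8; 8; 11; 12; 14; 14; 16; 16; 18; 18; 21; 22; 24]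
             d.-1),
      min_length_loc 'F_3 3 17 1 26,
      min_length_loc 'F_3 3 21 1 32
    & forall d : nat, 15 < d -> d <> 17 -> d <> 21 ->
        exists n : nat, min_length 'F_3 3 d n /\ min_length_loc 'F_3 3 d 1 n].
Proof.
split; [|exact: min_length_loc_exceptional|exact: min_length_loc_exceptional|].
  case=> //; do 15! [case=> [_|]; first exact: min_length_loc_exceptional].
  by [].
move=> d d15 d17 d21; exists (griesmer d).
have [m /and4P[/eqP sm cov m1 /eqP sum]] := griesmer_example d15 d17 d21.
have [|C [C_code C_loc]] := code_of_multiplicities _ sm cov m1; first by lia.
rewrite {}sum in C C_code C_loc *.
(* The bound holds for all codes and is attained by one with locality 1, so both minima equal
   [griesmer d]. *)
have lower n (D : {vspace 'rV['F_3]_n}) : is_code 3 d D -> griesmer d <= n.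
  by case/code_multiplicities=> m' [sm' le cov' _];
    rewrite (leq_trans (griesmer_bound sm' cov')).
by split; split; [exists C | move=> n [D /lower] | exists C
  | move=> n [D [/lower]]].
Qed.
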